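(* Let $q \geq 2$ be a fixed integer. Let $j = j(r) \geq 0$ be a real-valued function defined for positive integers $r$ such that $(1-1/q)r - j(r)$ is a positive integer, and suppose $j(r) = o\left(r^{1/3}\right)$ as $r \to \infty$. Then \[ A_q\left( r, \left( 1 - 1/q \right) r - j \right) \leq \left(2 + o(1)\right) (q - 1)\, r \quad \text{as } r\to\infty. \]
   Context: Let $[q] = \{1,\dots,q\}$. A subset $C \subseteq [q]^r$ is a $q$-ary code with block length $r$ and distance $s$ if any two distinct $x, y \in C$ differ in at least $s$ coordinates. $A_q(r,s)$ denotes the maximum size of such a code. *)

(* Defs.v *)
From mathcomp Require Import all_boot.

Set Implicit Arguments.
Unset Strict Implicit.
Unset Printing Implicit Defensive.

Definition hamming_dist (q r : nat) (x y : {ffun 'I_r -> 'I_q}) : nat :=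
  #|[set i : 'I_r | x i != y i]|.

Definition is_code (q r s : nat) (C : {set {ffun 'I_r -> 'I_q}}) : bool :=
  [forall x in C, forall y in C, (x != y) ==> (s <= hamming_dist x y)].

Definition max_code_size (q r s : nat) : nat :=
  \max_(C : {set {ffun 'I_r -> 'I_q}} | is_code s C) #|C|.

(* Main.v *)
Require Import Defs.
From mathcomp Require Import all_boot all_order all_algebra.
From mathcomp Require Import all_classical all_reals all_analysis.
From mathcomp Require Import ring lra.
Import Order.TTheory GRing.Theory Num.Theory.
Import numFieldNormedType.Exports.
Local Open Scope ring_scope.

(** Mapping each letter to a vertex of a regular simplex turns N codewords into
    N unit vectors in dimension n = (q - 1) r whose pairwise inner products are
    at most eps = q j / n = o(n^(-2/3)).  Their Gram matrix G has rank at most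
    n, so N^2 / n <= sum G_ik^2.  The positive off-diagonal entries contribute
    at most N^2 eps^2 to this sum.  For the negative parts b_ik, put
    S1(i) = sum_k b_ik and S2(i) = sum_k b_ik^2.  Since G is positive
    semidefinite and G + b is entrywise at most Id + eps, the matrix b has norm
    O(1 + N eps), whence sum_i S1(i)^2 = O(N (1 + N eps)^2).  Testing G on
    S2(i) delta_i + b_i gives S2(i)^2 <= S2(i) + eps S1(i)^2.  Altogether
    N / n <= 2 + O(N eps^2 + eps (1 + N eps)^2), and the error tends to 0 as
    long as N = O(n); this is ensured by passing to a subcode of size at most
    3 n. *)

(** Cauchy-Schwarz against the constant vector: the gap between the two sides is half the sum of all
    [(w i - w k) ^+ 2]. *)
Lemma sqr_sum_le_card (R : realFieldType) (I : finType) (w : I -> R) :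
  (\sum_i w i) ^+ 2 <= #|I|%:R * \sum_i w i ^+ 2.
Proof.
have : 0 <= \sum_i \sum_k (w i - w k) ^+ 2.
  by apply: sumr_ge0 => i _; apply: sumr_ge0 => k _; exact: sqr_ge0.
suff -> : \sum_i \sum_k (w i - w k) ^+ 2 =
    2 * (#|I|%:R * \sum_i w i ^+ 2) - 2 * (\sum_i w i) ^+ 2 by lra.
transitivity (\sum_i (#|I|%:R * w i ^+ 2 + \sum_k w k ^+ 2
    - 2 * (w i * \sum_k w k))).
  apply: eq_bigr => i _.
  under eq_bigr => k _ do rewrite sqrrB -mulr_natl.
  rewrite !big_split /= sumr_const sumrN -!mulr_sumr mulr_natl; ring.
rewrite !big_split /= sumrN sumr_const -!mulr_sumr -mulr_suml -mulr_natl.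
by ring.
Qed.

(** * Squared entries of a Gram matrix with small positive part *)

Section GramBound.
Context {R : realFieldType} {I : finType} (G : I -> I -> R) (eps : R).
Hypothesis eps_ge0 : 0 <= eps.
Hypothesis G_sym : forall i k, G i k = G k i.
Hypothesis G_diag : forall i, G i i = 1.
Hypothesis G_off : forall i k, i != k -> G i k <= eps.
Hypothesis G_psd : forall w : I -> R, 0 <= \sum_i \sum_k w i * w k * G i k.

Let N : R := #|I|%:R.
Let L : R := 1 + N * eps.
Let b i k : R := Num.max 0 (- G i k).
Let S1 i : R := \sum_k b i k.
Let S2 i : R := \sum_k b i k ^+ 2.

Let b_ge0 i k : 0 <= b i k.
Proof. by rewrite /b le_max lexx. Qed.

Let b_sym i k : b i k = b k i.
Proof. by rewrite /b G_sym. Qed.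

Let b_diag i : b i i = 0.
Proof. by rewrite /b G_diag; apply/max_idPl; lra. Qed.

Let bG i k : b i k * G i k = - b i k ^+ 2.
Proof. by rewrite /b; case: (leP 0 (- G i k)) => _; ring. Qed.

Let G_le i k : G i k <= (i == k)%:R + eps - b i k.
Proof.
case: eqVneq => [<-|ik]; first by rewrite G_diag b_diag subr0 lerDl.
move: eps_ge0; have := G_off i k ik; rewrite /b mulr0n; case: (leP 0 (- G i k)); lra.
Qed.

Let G_sqr_le i k : G i k ^+ 2 <= (i == k)%:R + eps ^+ 2 + b i k ^+ 2.
Proof.
case: eqVneq => [<-|ik].
  by rewrite G_diag b_diag expr1n expr0n /= addr0 lerDl sqr_ge0.
have := G_off i k ik; rewrite /b mulr0n; case: (leP 0 (- G i k)) => h1 h2.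
  by rewrite sqrrN; have := sqr_ge0 eps; lra.
by rewrite expr0n /= addr0 add0r lerXn2r ?nnegrE //; lra.
Qed.

Let S1_ge0 i : 0 <= S1 i.
Proof. exact: sumr_ge0. Qed.

Let N_ge0 : 0 <= N.
Proof. exact: ler0n. Qed.

Let L_gt0 : 0 < L.
Proof. by rewrite ltr_pwDl // mulr_ge0. Qed.

Let sum_delta i (f : I -> R) : \sum_k f k * (i == k)%:R = f i.
Proof.
rewrite (bigD1 i) //= eqxx mulr1 big1 ?addr0 // => k ki.
by rewrite eq_sym (negbTE ki) mulr0.
Qed.

(** Since [w] is nonnegative, [G_le] may be summed against the weights [w i * w k]; the left side of
    that sum is nonnegative by [G_psd]. *)
Let neg_form_le (w : I -> R) : (forall i, 0 <= w i) ->
  \sum_i \sum_k w i * w k * b i k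
    <= \sum_i w i ^+ 2 + eps * (\sum_i w i) ^+ 2.
Proof.
move=> w0; rewrite -subr_ge0; apply: le_trans (G_psd w) _.
have -> : \sum_i w i ^+ 2 + eps * (\sum_i w i) ^+ 2
    - \sum_i \sum_k w i * w k * b i k
  = \sum_i \sum_k w i * w k * ((i == k)%:R + eps - b i k).
  under [RHS]eq_bigr => i _.
    under eq_bigr => k _ do rewrite mulrBr mulrDr.
    rewrite !big_split /= sum_delta sumrN -mulr_suml -mulr_sumr; over.
  rewrite !big_split /= sumrN -!mulr_suml.
  by under [in RHS]eq_bigr => i _ do rewrite -expr2; ring.
by apply: ler_sum => i _; apply: ler_sum => k _; rewrite ler_wpM2l ?mulr_ge0.
Qed.

Let neg_form_leL (w : I -> R) : (forall i, 0 <= w i) ->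
  \sum_i \sum_k w i * w k * b i k <= L * \sum_i w i ^+ 2.
Proof.
move=> w0; apply: le_trans (neg_form_le _ w0) _.
have := ler_wpM2l eps_ge0 (sqr_sum_le_card _ _ w); rewrite /L -/N; lra.
Qed.

Let sum_S1_le : \sum_i S1 i <= L * N.
Proof.
have := neg_form_leL (fun=> 1) (fun=> ler01).
under eq_bigr => i _ do under eq_bigr => k _ do rewrite !mul1r.
by rewrite expr1n sumr_const.
Qed.

(* Replaces Perron-Frobenius for b: its quadratic form is tested on
   w = L + S1 only. *)
Let sum_sqr_S1_le : \sum_i S1 i ^+ 2 <= 3 * L ^+ 2 * N.
Proof.
have wp i : 0 <= L + S1 i by rewrite addr_ge0 // ltW.
have := neg_form_leL _ wp.
(* Only the cross terms [L * S1 i + L * S1 k] of the product are kept; by symmetry of [b] each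
   contributes [L * \sum_i S1 i ^+ 2]. *)
have : 2 * L * \sum_i S1 i ^+ 2
    <= \sum_i \sum_k (L + S1 i) * (L + S1 k) * b i k.
  have -> : 2 * L * \sum_i S1 i ^+ 2
      = \sum_i \sum_k (L * S1 i + L * S1 k) * b i k.
    under [RHS]eq_bigr => i _ do
      (under eq_bigr => k _ do rewrite mulrDl; rewrite big_split /=).
    rewrite big_split /= [X in _ = _ + X]exchange_big /=.
    under [X in _ = X + _]eq_bigr => i _ do rewrite -mulr_sumr -/(S1 i) -mulrA -expr2.
    under [X in _ = _ + X]eq_bigr => i _.
      under eq_bigr => k _ do rewrite b_sym.
      rewrite -mulr_sumr -/(S1 i) -mulrA -expr2; over.
    by rewrite -mulr_sumr; ring.
  apply: ler_sum => i _; apply: ler_sum => k _.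
  apply: ler_wpM2r => //.
  have := mulr_ge0 (S1_ge0 i) (S1_ge0 k); have := sqr_ge0 L; lra.
have -> : \sum_i (L + S1 i) ^+ 2
    = L ^+ 2 * N + 2 * L * \sum_i S1 i + \sum_i S1 i ^+ 2.
  under eq_bigr => i _ do rewrite sqrrD -mulr_natl mulrA.
  by rewrite !big_split /= sumr_const -[L ^+ 2 *+ _]mulr_natr -/N -mulr_sumr.
(* One copy of [L * \sum_i S1 i ^+ 2] is absorbed on the left. What remains is [L ^+ 3 * N] plus
   [2 * L ^+ 2 * \sum_i S1 i], at most [3 * L ^+ 3 * N]. *)
move=> h1 h2; have := le_trans h1 h2.
have := ler_wpM2l (ltW L_gt0) (ler_wpM2l (ltW L_gt0) sum_S1_le).
by move=> h3 h4; rewrite -(ler_pM2l L_gt0); lra.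
Qed.

Let S2_le i : S2 i <= 1 + eps * S1 i ^+ 2.
Proof.
have S2_0 : 0 <= S2 i by apply: sumr_ge0 => k _; exact: sqr_ge0.
(* If [S2 i] exceeds 1, then [S2 i - 1] is at most [S2 i * (S2 i - 1)]. *)
suff h : S2 i ^+ 2 <= S2 i + eps * S1 i ^+ 2.
  have := mulr_ge0 eps_ge0 (sqr_ge0 (S1 i)).
  by case: (leP (S2 i) 1) => ? ?; nra.
have := G_psd (fun k => S2 i * (i == k)%:R + b i k).
(* The point mass contributes [S2 i ^+ 2] and, by [bG], the cross terms contribute
   [- 2 * S2 i ^+ 2]; the weight [S2 i] minimizes their total. *)
have -> : \sum_k \sum_l (S2 i * (i == k)%:R + b i k)
     * (S2 i * (i == l)%:R + b i l) * G k l
  = - S2 i ^+ 2 + \sum_k \sum_l b i k * b i l * G k l.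
  under eq_bigr => k _.
    under eq_bigr => l _.
      rewrite (_ : _ * _ * _ = (S2 i * (i == k)%:R + b i k) * S2 i * G k l * (i == l)%:R
        + (S2 i * (b i l * G k l)) * (i == k)%:R + b i k * b i l * G k l); last by ring.
      over.
    rewrite !big_split /= sum_delta -mulr_suml -mulr_sumr; over.
  rewrite !big_split /= sum_delta.
  under [X in _ + _ * X + _]eq_bigr => l _ do rewrite bG.
  rewrite sumrN -/(S2 i).
  under eq_bigr => k _.
    rewrite (_ : _ * _ * _ = S2 i ^+ 2 * G k i * (i == k)%:R
        + S2 i * (b i k * G i k)); last first.
      by rewrite [G i k]G_sym; ring.
    over.
  rewrite big_split /= sum_delta -mulr_sumr G_diag.
  under [X in _ + _ * X + _ + _]eq_bigr => l _ do rewrite bG.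
  by rewrite sumrN -/(S2 i); ring.
suff : \sum_k \sum_l b i k * b i l * G k l <= S2 i + eps * S1 i ^+ 2 by lra.
have -> : S2 i + eps * S1 i ^+ 2
  = \sum_k \sum_l b i k * b i l * ((k == l)%:R + eps).
  under [RHS]eq_bigr => k _.
    under eq_bigr => l _ do rewrite mulrDr.
    rewrite big_split /= sum_delta -mulr_suml -mulr_sumr -expr2; over.
  by rewrite big_split /= -!mulr_suml -/(S1 i) -/(S2 i); ring.
apply: ler_sum => k _; apply: ler_sum => l _.
by apply: ler_wpM2l; rewrite ?mulr_ge0 //; have := G_le k l; have := b_ge0 k l; lra.
Qed.

(** The constant 2 collects one unit per row from the diagonal and one from the negative entries,
    through [S2_le]. *)
Lemma sum_sqr_gram_le :
  \sum_i \sum_k G i k ^+ 2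
    <= N * (2 + N * eps ^+ 2 + 3 * eps * (1 + N * eps) ^+ 2).
Proof.
have h : \sum_i S2 i <= N + eps * (3 * L ^+ 2 * N).
  apply: le_trans (_ : \sum_i (1 + eps * S1 i ^+ 2) <= _); first exact: ler_sum.
  rewrite big_split /= sumr_const -mulr_sumr lerD2l.
  exact: ler_wpM2l.
suff : \sum_i \sum_k G i k ^+ 2 <= N + N * N * eps ^+ 2 + \sum_i S2 i.
  by move: h; rewrite /L; lra.
have -> : N + N * N * eps ^+ 2 + \sum_i S2 i
   = \sum_i \sum_k (1 * (i == k)%:R + eps ^+ 2 + b i k ^+ 2).
  under [RHS]eq_bigr => i _.
    rewrite !big_split /= (sum_delta i (fun=> 1)) sumr_const -mulr_natl.
    rewrite -/N -/(S2 i); over.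
  by rewrite !big_split /= !sumr_const -[N * _ *+ _]mulr_natl -/N mulrA.
by apply: ler_sum => i _; apply: ler_sum => k _; rewrite mul1r.
Qed.

End GramBound.

(** The matrices [U U^T] and [T = U^T U] have the same Frobenius norm, and [T - c P] has nonnegative
    squared norm. Taking for [P] a projection that fixes the rows of [U] yields the rank bound on
    the Gram matrix. *)
Lemma frobenius_test_le {R : realFieldType} {I J : finType}
    (u : I -> J -> R) (P : J -> J -> R) (c : R) :
  2 * c * (\sum_i \sum_p \sum_s u i p * u i s * P p s)
    - c ^+ 2 * (\sum_p \sum_s P p s ^+ 2)
  <= \sum_i \sum_k (\sum_p u i p * u k p) ^+ 2.
Proof.
pose T p s := \sum_i u i p * u i s.
have -> : \sum_i \sum_k (\sum_p u i p * u k p) ^+ 2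
    = \sum_p \sum_s T p s ^+ 2.
  transitivity (\sum_i \sum_k \sum_p \sum_s (u i p * u k p) * (u i s * u k s)).
    apply: eq_bigr => i _; apply: eq_bigr => k _.
    by rewrite expr2 mulr_suml; apply: eq_bigr => p _; rewrite mulr_sumr.
  under eq_bigr => i _ do (rewrite exchange_big /=;
    under eq_bigr => p _ do rewrite exchange_big /=).
  rewrite exchange_big /=; apply: eq_bigr => p _.
  rewrite exchange_big /=; apply: eq_bigr => s _.
  rewrite expr2 mulr_suml; apply: eq_bigr => i _.
  by rewrite mulr_sumr; apply: eq_bigr => k _; ring.
have -> : \sum_i \sum_p \sum_s u i p * u i s * P p s
    = \sum_p \sum_s T p s * P p s.
  rewrite exchange_big /=; apply: eq_bigr => p _.
  rewrite exchange_big /=; apply: eq_bigr => s _.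
  by rewrite mulr_suml.
rewrite !mulr_sumr -sumrB; apply: ler_sum => p _.
rewrite !mulr_sumr -sumrB; apply: ler_sum => s _.
by have := sqr_ge0 (T p s - c * P p s); lra.
Qed.

(** * Simplex encoding of the alphabet *)

Section Simplex.
Context {R : realFieldType} {q : nat}.
Hypothesis q_gt0 : (0 < q)%N.

(* Orthogonal projection of R^q onto the hyperplane of zero-sum vectors; its
   rows are the vertices of a regular simplex. *)
Definition simplex (a b : 'I_q) : R := (a == b)%:R - 1 / q%:R.

Lemma simplex_idem a b : \sum_c simplex a c * simplex b c = simplex a b.
Proof.
have q0 : q%:R != 0 :> R by rewrite pnatr_eq0 -lt0n.
transitivity (\sum_c ((a == c)%:R * (b == c)%:R - 1 / q%:R * (a == c)%:R
   - 1 / q%:R * (b == c)%:R + (1 / q%:R) ^+ 2) : R).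
  by apply: eq_bigr => c _; rewrite /simplex; ring.
have delta (d : 'I_q) (f : 'I_q -> R) : \sum_c f c * (d == c)%:R = f d.
  rewrite (bigD1 d) //= eqxx mulr1 big1 ?addr0 // => c cd.
  by rewrite eq_sym (negbTE cd) mulr0.
rewrite !big_split /= !sumrN sumr_const card_ord !delta /simplex -[_ ^+ 2 *+ _]mulr_natr.
by field.
Qed.

(** For a symmetric idempotent the squared Frobenius norm is the trace, here the dimension of the
    hyperplane. *)
Lemma sum_sqr_simplex : \sum_a \sum_b simplex a b ^+ 2 = q%:R - 1.
Proof.
have q0 : q%:R != 0 :> R by rewrite pnatr_eq0 -lt0n.
under eq_bigr => a _ do
  (under eq_bigr => b _ do rewrite expr2; rewrite simplex_idem).
rewrite /simplex; under eq_bigr => a _ do rewrite eqxx.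
by rewrite sumr_const card_ord -[(_ - _) *+ _]mulr_natr mulrBl divfK // mul1r.
Qed.

Lemma sum_simplex_words r (x y : {ffun 'I_r -> 'I_q}) :
  \sum_t simplex (x t) (y t) = (1 - 1 / q%:R) * r%:R - (hamming_dist x y)%:R.
Proof.
rewrite /simplex big_split /= sumr_const card_ord -mulr_natr.
suff -> : \sum_t (x t == y t)%:R = r%:R - (hamming_dist x y)%:R :> R by ring.
rewrite /hamming_dist -sum1_card natr_sum.
have -> : r%:R = \sum_(t < r) 1 :> R by rewrite sumr_const card_ord.
rewrite [X in _ - X]big_mkcond /= -sumrB.
by apply: eq_bigr => t _; rewrite inE; case: eqP => _; rewrite ?subr0 ?subrr.
Qed.

End Simplex.

(** * Bounds on the size of a code *)

Lemma code_family_bound {R : realFieldType} {I : finType} (q r : nat) (j : R)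
    (c : I -> {ffun 'I_r -> 'I_q}) (N : R := #|I|%:R)
    (n : R := (q%:R - 1) * r%:R) (eps : R := q%:R * j / n) :
  (2 <= q)%N -> (0 < r)%N -> 0 <= j ->
  (forall i k, i != k ->
    (1 - 1 / q%:R) * r%:R - j <= (hamming_dist (c i) (c k))%:R) ->
  N <= n * (2 + N * eps ^+ 2 + 3 * eps * (1 + N * eps) ^+ 2).
Proof.
move=> q2 r0 j0 dist.
have q0' : (0 < q)%N by exact: ltn_trans q2.
have q0 : 0 < q%:R :> R by rewrite ltr0n.
have q1 : 0 < q%:R - 1 :> R by rewrite subr_gt0 ltr1n.
have rR : 0 < r%:R :> R by rewrite ltr0n.
have n0 : 0 < n by rewrite mulr_gt0.
pose u i (p : 'I_r * 'I_q) : R := simplex (c i p.1) p.2.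
pose K i k : R := \sum_p u i p * u k p.
have KE i k : K i k = \sum_t simplex (c i t) (c k t).
  rewrite /K -(pair_bigA _ (fun t a => u i (t, a) * u k (t, a))) /=.
  by apply: eq_bigr => t _; rewrite /u /= simplex_idem.
(* The common squared length of the encoded words, namely [(1 - 1 / q%:R) * r%:R]. *)
pose kap : R := n / q%:R.
have kap0 : 0 < kap by rewrite divr_gt0.
have kapE : (1 - 1 / q%:R) * r%:R = kap by rewrite /kap /n; field; lra.
have K_diag i : K i i = kap.
  rewrite KE sum_simplex_words kapE /hamming_dist.
  rewrite (_ : [set _ | _] = finset.set0) ?cards0 ?subr0 //.
  by apply/setP => t; rewrite !inE eqxx.
have trK : N ^+ 2 * kap ^+ 2 / n <= \sum_i \sum_k K i k ^+ 2.
  (* The block-diagonal projection with [r] simplex blocks: it fixes every [u i] and has trace [n].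
     The factor [N * kap / n] chosen below maximizes [2 * c * (N * kap) - c ^+ 2 * n]. *)
  pose P (p s : 'I_r * 'I_q) : R := (p.1 == s.1)%:R * simplex p.2 s.2.
  have delta (t : 'I_r) (f : 'I_r -> R) : \sum_s (t == s)%:R * f s = f t.
    rewrite (bigD1 t) //= eqxx mul1r big1 ?addr0 // => s st.
    by rewrite eq_sym (negbTE st) mul0r.
  have := frobenius_test_le u P (N * kap / n).
  have -> : \sum_p \sum_s P p s ^+ 2 = n.
    rewrite -(pair_bigA _ (fun t a => \sum_s P (t, a) s ^+ 2)) /=.
    transitivity (\sum_(t < r) \sum_(a < q) \sum_(b < q) simplex a b ^+ 2 : R).
      apply: eq_bigr => t _; apply: eq_bigr => a _.
      rewrite -(pair_bigA _ (fun s b => P (t, a) (s, b) ^+ 2)) /= /P /=.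
      transitivity (\sum_s (t == s)%:R * \sum_b (simplex a b : R) ^+ 2).
        apply: eq_bigr => s _; rewrite mulr_sumr; apply: eq_bigr => b _.
        by case: eqP; rewrite ?mul1r ?mul0r ?expr0n.
      by rewrite delta.
    rewrite sumr_const card_ord sum_sqr_simplex //.
    by rewrite -[LHS]mulr_natr.
  have -> : \sum_i \sum_p \sum_s u i p * u i s * P p s = N * kap.
    transitivity (\sum_i K i i).
      apply: eq_bigr => i _; apply: eq_bigr => -[t a] _.
      under eq_bigr => s _ do rewrite -mulrA.
      rewrite -mulr_sumr; congr (_ * _).
      rewrite -(pair_bigA _ (fun s b => u i (s, b) * P (t, a) (s, b))) /= /P /=.
      transitivity (\sum_s (t == s)%:R * \sum_b u i (s, b) * simplex a b).
        by apply: eq_bigr => s _; rewrite mulr_sumr; apply: eq_bigr => b _; ring.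
      by rewrite delta /u /= simplex_idem.
    by under eq_bigr => i _ do rewrite K_diag; rewrite sumr_const -mulr_natl.
  apply: le_trans; rewrite le_eqVlt; apply/orP; left; apply/eqP.
  by field; lra.
pose G i k := K i k / kap.
have G_sym i k : G i k = G k i.
  by rewrite /G; congr (_ / _); apply: eq_bigr => p _; rewrite mulrC.
have G_diag i : G i i = 1 by rewrite /G K_diag divff // gt_eqF.
have eps0 : 0 <= eps by rewrite divr_ge0 ?mulr_ge0 // ltW.
have G_off i k : i != k -> G i k <= eps.
  move=> /dist h; rewrite ler_pdivrMr // KE sum_simplex_words.
  rewrite (_ : eps * kap = j); last by rewrite /eps /kap; field; lra.
  by move: h; lra.
have G_psd (w : I -> R) : 0 <= \sum_i \sum_k w i * w k * G i k.
  have -> : \sum_i \sum_k w i * w k * G i k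
      = (\sum_p (\sum_i w i * u i p) ^+ 2) / kap.
    rewrite /G /K mulr_suml.
    transitivity (\sum_i \sum_k \sum_p w i * u i p * (w k * u k p) / kap).
      apply: eq_bigr => i _; apply: eq_bigr => k _.
      by rewrite mulr_suml mulr_sumr; apply: eq_bigr => p _; ring.
    under eq_bigr => i _ do rewrite exchange_big /=.
    rewrite exchange_big /=; apply: eq_bigr => p _.
    rewrite expr2 -mulrA mulr_suml; apply: eq_bigr => i _.
    by rewrite mulrA mulr_sumr mulr_suml.
  by rewrite divr_ge0 ?(ltW kap0) // sumr_ge0 // => p _; exact: sqr_ge0.
have := sum_sqr_gram_le G eps eps0 G_sym G_diag G_off G_psd.
have -> : \sum_i \sum_k G i k ^+ 2 = (\sum_i \sum_k K i k ^+ 2) / kap ^+ 2.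
  rewrite mulr_suml; apply: eq_bigr => i _; rewrite mulr_suml.
  by apply: eq_bigr => k _; rewrite /G expr_div_n.
rewrite ler_pdivrMr ?exprn_gt0 // -/N => /(le_trans trK).
have N0 : 0 <= N by exact: ler0n.
set B : R := 2 + _ + _.
have B0 : 0 <= B.
  apply: addr_ge0; last by apply: mulr_ge0 (sqr_ge0 _); exact: mulr_ge0.
  by apply: addr_ge0 => //; exact: mulr_ge0 N0 (sqr_ge0 _).
rewrite ler_pdivrMr //.
have [N_gt0 h|N_le0 _] := ltP 0 N; last first.
  by apply: le_trans N_le0 _; exact: mulr_ge0 (ltW n0) B0.
have Nkap0 : 0 < N * kap ^+ 2 by rewrite mulr_gt0 ?exprn_gt0.
rewrite -(ler_pM2l Nkap0); have -> : N * kap ^+ 2 * N = N ^+ 2 * kap ^+ 2 by ring.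
by apply: le_trans h _; rewrite le_eqVlt; apply/orP; left; apply/eqP; ring.
Qed.

Lemma max_code_size_le {R : realFieldType} (q r s : nat) (j : R)
    (n : R := (q%:R - 1) * r%:R) (y : R := q%:R * j)
    (e : R := 3 * (y + (1 + 3 * y) ^+ 2) * y / n) :
  (2 <= q)%N -> (0 < r)%N -> 0 <= j ->
  s%:R = (1 - 1 / q%:R) * r%:R - j -> e < 1 ->
  (max_code_size q r s)%:R <= (2 + e) * n.
Proof.
move=> q2 r0 j0 sE e1.
have q0 : 0 < q%:R :> R by rewrite ltr0n (ltn_trans _ q2).
have q1 : 0 < q%:R - 1 :> R by rewrite subr_gt0 ltr1n.
have rR : 0 < r%:R :> R by rewrite ltr0n.
have n0 : 0 < n by rewrite mulr_gt0.
have y0 : 0 <= y by rewrite mulr_ge0 // ltW.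
have e0 : 0 <= e.
  by rewrite divr_ge0 ?(ltW n0) // !mulr_ge0 ?addr_ge0 ?sqr_ge0.
have bound0 : 0 <= (2 + e) * n by rewrite mulr_ge0 ?addr_ge0 // ltW.
apply: (big_ind (fun m : nat => m%:R <= (2 + e) * n)) => //.
  by move=> m1 m2 h1 h2; rewrite /maxn; case: ifP.
move=> C C_code.
(* Subcodes of size at most [3 * n] have [k%:R * eps <= 3 * y], which turns the error terms into
   [e]. *)
pose n3 := (3 * ((q - 1) * r))%N.
have n3E : n3%:R = 3 * n :> R by rewrite !natrM natrB // (ltn_trans _ q2).
have small k : (k <= #|C|)%N -> (k <= n3)%N -> k%:R <= (2 + e) * n.
  move=> kC kn.
  pose c (i : 'I_k) := enum_val (widen_ord kC i).
  have dist i l : i != l ->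
      (1 - 1 / q%:R) * r%:R - j <= (hamming_dist (c i) (c l))%:R.
    move=> il; rewrite -sE ler_nat.
    move/forall_inP: C_code => /(_ _ (enum_valP (widen_ord kC i))).
    move=> /forall_inP /(_ _ (enum_valP (widen_ord kC l))) /implyP; apply.
    by rewrite (inj_eq enum_val_inj).
  have := code_family_bound q r j c q2 r0 j0 dist.
  rewrite card_ord -/n -/y => /le_trans; apply.
  rewrite mulrC ler_pM2r // -addrA lerD2l.
  set eps := y / n.
  have eps0 : 0 <= eps by rewrite divr_ge0 // ltW.
  have keps : k%:R * eps <= 3 * y.
    apply: le_trans (_ : 3 * n * eps <= _).
      by rewrite ler_wpM2r // -n3E ler_nat.
    by rewrite le_eqVlt; apply/orP; left; apply/eqP; rewrite /eps; field; rewrite gt_eqF.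
  have keps0 : 0 <= k%:R * eps by rewrite mulr_ge0.
  have -> : e = 3 * y * eps + 3 * eps * (1 + 3 * y) ^+ 2.
    by rewrite /e /eps; field; rewrite gt_eqF.
  rewrite expr2 mulrA lerD ?ler_wpM2r // ler_wpM2l ?(mulr_ge0 _ eps0) //.
  by move: keps keps0 y0 => ? ? ?; apply: lerXn2r; rewrite ?nnegrE; lra.
have [Cn|nC] := leqP #|C| n3; first exact: small.
(* A larger code would contain a subcode of size exactly [3 * n], forcing [3 <= 2 + e] against
   [e < 1]. *)
have := small n3 (ltnW nC) (leqnn _); rewrite n3E ler_pM2r //; lra.
Qed.

(** * Asymptotics *)

Local Open Scope classical_set_scope.
Local Open Scope ring_scope.

(* [D] is the domain of [j].  It is not required to be all positive integers:
   for r = 1 no j >= 0 makes (1 - 1/q) r - j a positive integer.  The values of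
   [j] outside [D] are irrelevant, and asymptotics are along r -> oo in [D].
   [Num.truncn] only casts to [nat] a real already assumed to be one. *)
Theorem theorem1p3 (R : realType) (q : nat) (D : set nat) (j : nat -> R) :
  (2 <= q)%N ->
  (forall r : nat, D r ->
     [/\ (0 < r)%N, 0 <= j r,
         0 < (1 - 1 / q%:R) * r%:R - j r &
         (1 - 1 / q%:R) * r%:R - j r \is a Num.nat]) ->
  (j : nat -> R^o) =o_ (within D \oo) (fun r : nat => r%:R `^ (1 / 3) : R^o) ->
  exists e : nat -> R,
    (e : nat -> R^o) =o_ (within D \oo) (fun _ : nat => 1 : R^o) /\
    \forall r \near within D \oo,
      (max_code_size q r (Num.truncn ((1 - 1 / q%:R) * r%:R - j r)))%:R
        <= (2 + e r) * (q%:R - 1) * r%:R.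
Proof.
move=> q2 Dj jo.
have q0 : 0 < q%:R :> R by rewrite ltr0n (ltn_trans _ q2).
have q1 : 1 <= q%:R - 1 :> R by rewrite lerBrDr (ler_nat _ 2).
pose e r : R := 3 * (q%:R * j r + (1 + 3 * (q%:R * j r)) ^+ 2) * (q%:R * j r)
  / ((q%:R - 1) * r%:R).
have e_small (c : R) : 0 < c -> \forall r \near within D \oo, `|e r| <= c.
  move=> c0.
  (* With [a] the cube root of [r] and [y <= eta * a <= a], the factor
     [3 * (1 + 7 * y + 9 * y ^+ 2)] is at most [51 * a ^+ 2], as [1 <= a]. The remaining [y]
     supplies [eta * a], so the numerator is at most [51 * eta * r]. *)
  pose eta : R := Num.min 1 (c / 51).
  have eta0 : 0 < eta by rewrite lt_min ltr01 divr_gt0.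
  have eta1 : eta <= 1 by rewrite ge_min lexx.
  have etac : 51 * eta <= c by rewrite mulrC -ler_pdivlMr // ge_min lexx orbT.
  have /eqoP/(_ (eta / q%:R)) := jo.
  rewrite divr_gt0 // => /(_ isT).
  rewrite !near_withinE; apply: filterS => r jr Dr.
  have [r0 j0 _ _] := Dj r Dr; have {jr} := jr Dr.
  have rR : 1 <= r%:R :> R by rewrite ler1n.
  set a := r%:R `^ (1 / 3).
  have a3 : a ^+ 3 = r%:R.
    by rewrite -powR_mulrn ?powR_ge0 // -powRrM divfK // powRr1.
  have a1 : 1 <= a.
    have : (1 : R) `^ (1 / 3) <= a by apply: ge0_ler_powR; rewrite ?nnegrE; lra.
    by rewrite powR1.
  rewrite (ger0_norm j0) (ger0_norm (le_trans ler01 a1)).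
  rewrite mulrAC ler_pdivlMr // [j r * _]mulrC.
  have n0 : 0 < (q%:R - 1) * r%:R :> R by apply: mulr_gt0; exact: lt_le_trans ltr01 _.
  have y0 : 0 <= q%:R * j r by rewrite mulr_ge0 // ltW.
  rewrite /e; move: (q%:R * j r) y0 => y y0 ya.
  rewrite ger0_norm; last first.
    by rewrite divr_ge0 ?(ltW n0) // !mulr_ge0 ?addr_ge0 ?sqr_ge0.
  rewrite ler_pdivrMr //.
  have y_a : y <= a by apply: le_trans ya _; rewrite ler_piMl //; lra.
  have y1 : 3 * (y + (1 + 3 * y) ^+ 2) <= 51 * a ^+ 2.
    have : y ^+ 2 <= a ^+ 2 by rewrite lerXn2r ?nnegrE //; lra.
    have : a <= a ^+ 2 by rewrite expr2 ler_peMl //; lra.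
    lra.
  apply: le_trans (_ : 51 * a ^+ 2 * (eta * a) <= _).
    by rewrite ler_pM // ?mulr_ge0 ?addr_ge0 ?sqr_ge0.
  apply: le_trans (_ : c * r%:R <= _).
    have -> : 51 * a ^+ 2 * (eta * a) = 51 * eta * r%:R by rewrite -a3; ring.
    by rewrite ler_wpM2r //; lra.
  rewrite ler_wpM2l ?(ltW c0) // ler_peMl //; lra.
exists e; split.
  apply/eqoP => c c0; have := e_small c c0.
  by apply: filterS => r; rewrite normr1 mulr1.
(* Eventually [e r <= 1 / 2], which meets the condition [e < 1] of [max_code_size_le]. *)
have := e_small (1 / 2); rewrite divr_gt0 // => /(_ isT).
rewrite !near_withinE; apply: filterS => r er Dr.
have [r0 j0 _ jnat] := Dj r Dr.
rewrite -mulrA; apply: max_code_size_le => //; first exact: truncnK.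
rewrite -/(e r); have := er Dr; have := ler_norm (e r); lra.
Qed.
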